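(* Adaptive Huffman encodings are particular cases of encodings by generalized adaptive codes. That is, for an alphabet $\Sigma$, there exist a function $F:\mathbb{N}^{*}\times\Sigma^{+}\to\Sigma^{*}$ and a generalized adaptive code $c_F:\Sigma\times\Sigma^{*}\to\Delta^{+}$ with adaptive function $F$ (where $\Delta=\{0,1\}$ is the alphabet of edge labels of the Huffman trees) such that for every string $w=w_1w_2\ldots w_h\in\Sigma^{+}$ (with $w_i\in\Sigma$) one has $$\overline{c_F}(w)=\mathrm{code}(w_1,\mathcal{T}_0(w))\,\mathrm{code}(w_2,\mathcal{T}_1(w))\cdots \mathrm{code}(w_h,\mathcal{T}_{h-1}(w)),$$ the right-hand side being the adaptive Huffman encoding of $w$.
   Context: $\mathbb{N}^{*}$ is the set of nonzero natural numbers; $\Sigma^{*}$ is the set of finite strings over $\Sigma$, $\lambda$ is the empty string, $\Sigma^{+}=\Sigma^{*}\setminus\{\lambda\}$; juxtaposition denotes concatenation. Generalized adaptive code (GA code): let $\Sigma,\Delta$ be alphabets and $F:\mathbb{N}^{*}\times\Sigma^{+}\to\Sigma^{*}$ a function. A function $c_F:\Sigma\times\Sigma^{*}\to\Delta^{+}$ is called a GA code, with adaptive function $F$, if the map $\overline{c_F}:\Sigma^{*}\to\Delta^{*}$ given by $\overline{c_F}(\lambda)=\lambda$ and $\overline{c_F}(\sigma_1\sigma_2\ldots\sigma_m)=c_F(\sigma_1,F(1,\sigma_1\ldots\sigma_m))\cdots c_F(\sigma_m,F(m,\sigma_1\ldots\sigma_m))$ for all $\sigma_1\ldots\sigma_m\in\Sigma^{+}$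 is injective. Adaptive Huffman trees: for an input string $w=w_1\ldots w_h$ over $\Sigma$, the adaptive Huffman algorithm constructs a sequence of Huffman trees $\mathcal{T}_0(w),\mathcal{T}_1(w),\ldots,\mathcal{T}_h(w)$, whose leaves are labelled by the symbols of $\Sigma$ and whose nodes carry frequencies. $\mathcal{T}_0(w)$ is the Huffman tree associated to the alphabet $\Sigma$, with the assumption that each symbol in $\Sigma$ has frequency $1$. For $0\le i<h$, the tree $\mathcal{T}_{i+1}(w)$ (associated to $w_1\ldots w_{i+1}$) is obtained from $\mathcal{T}_i(w)$ by the sibling transformation. Start with the current node being the leaf of $w_{i+1}$, let $k$ be its frequency, and compare it with its successors in the tree (from left to right and from bottom to top). If the immediate successor has frequency $k+1$ or greater, nothing has to be changed; otherwise, the current node is swapped with the last successor which has frequency $k$ or smaller (only if this successor is not its parent). The frequency of the current node is then incremented from $k$ to $k+1$. If the current node is the root, the loop terminates; otherwise it continues with the parent of the current node. In each tree, edges to left children are labelled $0$ and edges to right children are labelled $1$; $\mathrm{code}(\sigma,\mathcal{T}_i(w))$ denotes the codeword associated to the symbol $\sigma$ in $\mathcal{T}_i(w)$, i.e. the string of edge labels on the path from the root to the leaf labelled $\sigma$.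
   Formalization: The alphabet Σ is assumed to have at least two symbols: with a single symbol the Huffman tree is one leaf, its codeword is λ, and no code with values in Δ⁺ can produce the encoding. *)

(* Defs.v *)
From HB Require Import structures.
From mathcomp Require Import all_boot.

Set Implicit Arguments.
Unset Strict Implicit.
Unset Printing Implicit Defensive.

Section GeneralizedAdaptiveCodes.
Variables Sigma Delta : finType.

(* F is only ever evaluated at (i, w) with 1 <= i <= size w, hence inside
   N^* x Sigma^+; its values elsewhere are irrelevant. *)
Definition ga_encode (F : nat -> seq Sigma -> seq Sigma)
    (c : Sigma -> seq Sigma -> seq Delta) (w : seq Sigma) : seq Delta :=
  flatten [seq c iw.2 (F iw.1 w) | iw <- zip (iota 1 (size w)) w].

(* The first conjunct says that c takes its values in Delta^+. *)
Definition ga_code (F : nat -> seq Sigma -> seq Sigma)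
    (c : Sigma -> seq Sigma -> seq Delta) : Prop :=
  (forall s u, c s u != [::]) /\ injective (ga_encode F c).

End GeneralizedAdaptiveCodes.

(* Each node stores its own frequency, because the sibling transformation
   increments the frequencies one node at a time. *)
Inductive htree (Sigma : Type) : Type :=
| Leaf of nat & Sigma
| Node of nat & htree Sigma & htree Sigma.

Section HuffmanTreeEquality.
Variable Sigma : eqType.

Lemma htree_comparable : comparable (htree Sigma).
Proof.
move=> t u; rewrite /decidable.
decide equality; try exact: eq_comparable; decide equality.
Qed.

HB.instance Definition _ := comparableMixin htree_comparable.
End HuffmanTreeEquality.

Section HuffmanTrees.
Variable Sigma : eqType.
Implicit Types (t u : htree Sigma) (s : Sigma).

Definition freq t : nat := match t with Leaf k _ => k | Node k _ _ => k end.

Fixpoint symbols t : seq Sigma :=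
  match t with
  | Leaf _ s => [:: s]
  | Node _ l r => symbols l ++ symbols r
  end.

(* Huffman's algorithm, with every possible way of breaking ties and of
   choosing the left and the right child: [huffman_from ts t] holds when t can
   be obtained from the forest ts by repeatedly merging two trees of least
   frequency. *)
Inductive huffman_from : seq (htree Sigma) -> htree Sigma -> Prop :=
| HuffmanDone t : huffman_from [:: t] t
| HuffmanMerge ts x y rest t :
    perm_eq ts [:: x, y & rest] ->
    (forall z, z \in rest -> (freq x <= freq z) && (freq y <= freq z)) ->
    huffman_from (Node (freq x + freq y) x y :: rest) t ->
    huffman_from ts t.

(* A node is designated by the path from the root to it; false (= 0) goes to
   the left child and true (= 1) to the right child. *)
Fixpoint subtree t (p : seq bool) : htree Sigma :=
  match t, p with
  | Node _ l r, b :: p' => subtree (if b then r else l) p'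
  | _, _ => t
  end.

Fixpoint replace t (p : seq bool) u : htree Sigma :=
  match p, t with
  | [::], _ => u
  | b :: p', Node k l r =>
      if b then Node k l (replace r p' u) else Node k (replace l p' u) r
  | _ :: _, Leaf _ _ => t
  end.

Definition freq_at t (p : seq bool) : nat := freq (subtree t p).

(* Meaningful only for a symbol occurring in t. *)
Fixpoint code s t : seq bool :=
  match t with
  | Leaf _ _ => [::]
  | Node _ l r =>
      if s \in symbols l then false :: code s l else true :: code s r
  end.

Fixpoint height t : nat :=
  match t with
  | Leaf _ _ => 0
  | Node _ l r => (maxn (height l) (height r)).+1
  end.

Fixpoint level t (d : nat) : seq (seq bool) :=
  match d, t with
  | 0, _ => [:: [::]]
  | d'.+1, Node _ l r =>
      map (cons false) (level l d') ++ map (cons true) (level r d')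
  | _.+1, Leaf _ _ => [::]
  end.

(* All nodes, level by level from the deepest level up to the root, and from
   left to right within a level. *)
Definition node_order t : seq (seq bool) :=
  flatten [seq level t d | d <- rev (iota 0 (height t).+1)].

Definition successors t (p : seq bool) : seq (seq bool) :=
  drop (index p (node_order t)).+1 (node_order t).

Definition swap t (p q : seq bool) : htree Sigma :=
  replace (replace t p (subtree t q)) q (subtree t p).

(* The comparison of the node at p with its successors; the result is the new
   tree together with the new position of the current node. The test
   [prefix q p] excludes an exchange with the parent. It excludes the farther
   ancestors too, for which an exchange has no meaning; when frequencies are
   positive and nondecreasing along [node_order], no ancestor qualifies. *)
Definition promote t (p : seq bool) : htree Sigma * seq bool :=
  let k := freq_at t p in
  let qs := successors t p in
  if qs is q0 :: _ then
    if k.+1 <= freq_at t q0 then (t, p)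
    else
      let q := last q0 [seq q' <- qs | freq_at t q' <= k] in
      if prefix q p then (t, p) else (swap t p q, q)
  else (t, p).

Definition incr_root t : htree Sigma :=
  match t with
  | Leaf k s => Leaf k.+1 s
  | Node k l r => Node k.+1 l r
  end.

Definition incr_at t (p : seq bool) : htree Sigma :=
  replace t p (incr_root (subtree t p)).

(* n bounds the number of moves to a parent. A node is never deeper after
   [promote], since its successors are not, so the depth of the starting node
   is enough and the loop always ends at the root. *)
Fixpoint sibling_loop (n : nat) t (p : seq bool) : htree Sigma :=
  let: (t1, q) := promote t p in
  let t2 := incr_at t1 q in
  match n, q with
  | n'.+1, b :: q' => sibling_loop n' t2 (belast b q')
  | _, _ => t2
  end.

Definition sibling_transformation t s : htree Sigma :=
  sibling_loop (size (code s t)) t (code s t).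

(* T_i(w), for the initial tree T0 *)
Definition adaptive_tree (T0 : htree Sigma) (i : nat) (w : seq Sigma) :
    htree Sigma :=
  foldl sibling_transformation T0 (take i w).

Definition adaptive_huffman_encode (T0 : htree Sigma) (w : seq Sigma) :
    seq bool :=
  flatten [seq code iw.2 (adaptive_tree T0 iw.1 w)
          | iw <- zip (iota 0 (size w)) w].

End HuffmanTrees.

Definition initial_huffman_tree (Sigma : finType) (t : htree Sigma) : Prop :=
  huffman_from [seq Leaf 1 s | s <- enum Sigma] t.

(* Main.v *)
Require Import Defs.
From mathcomp Require Import all_boot.

(** Take F(i, w) = w_1 ... w_{i-1}, so that c_F can rebuild T_{i-1}(w).  The
    sibling transformation only exchanges disjoint subtrees, hence every
    T_i(w) still carries all the symbols and its codewords form a prefix code;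
    the decoder knows T_0(w), and therefore recovers w_1, then T_1(w), then
    w_2, and so on. *)

Section SymbolsPreserved.
Variable Sigma : eqType.
Implicit Types (t u l r : htree Sigma) (s : Sigma) (p q : seq bool).

Lemma mem_level_size t d p : p \in level t d -> size p = d.
Proof.
elim: d t p => [|d IHd] [k s|k l r] p //=; try by rewrite inE => /eqP->.
by rewrite mem_cat => /orP[] /mapP[p' /IHd <- ->].
Qed.

Lemma mem_node_order t p : p \in node_order t -> p \in level t (size p).
Proof.
by case/flatten_mapP=> d _ pd; rewrite (mem_level_size _ _ _ pd).
Qed.

Lemma node_order_pairwise t :
  pairwise (fun p q => size q <= size p) (node_order t).
Proof.
rewrite /node_order; elim: (height t).+1 => [//|h IHh].
(* After reversal the added level [h] stands in front of all shallower levels. *)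
rewrite -addn1 iotaD rev_cat /= pairwise_cat IHh andbT; apply/andP; split.
  apply/allrelP=> p q /mem_level_size-> /flatten_mapP[d].
  by rewrite mem_rev mem_iota => /andP[_ dh] /mem_level_size->; exact: ltnW.
have: all (fun p => size p == h) (level t h).
  by apply/allP=> p /mem_level_size->.
rewrite add0n; elim: (level t h) => //= p ps IHps /andP[/eqP-> sz_ps].
by rewrite IHps // andbT; apply/allP=> q /(allP sz_ps)/eqP->.
Qed.

(** A successor cannot lie strictly below the current node; with the test [prefix q p] in [promote],
    this makes the two exchanged subtrees disjoint. *)
Lemma successors_size t p q :
  p \in node_order t -> q \in successors t p -> size q <= size p.
Proof.
move=> pt; have := node_order_pairwise t.
rewrite -{1}(cat_take_drop (index p (node_order t)) (node_order t)).
rewrite (drop_nth p) ?index_mem // nth_index // pairwise_cat pairwise_cons.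
by case/and4P=> _ _ /allP le_p _; exact: le_p.
Qed.

Lemma mem_level_node k l r b d p :
  (b :: p \in level (Node k l r) d.+1) = (p \in level (if b then r else l) d).
Proof.
rewrite mem_cat; apply/orP/idP=> [[] /mapP[q qt [-> ->]] //|].
by case: b => pt; [right | left]; rewrite map_f.
Qed.

Lemma mem_level_replace t u p q :
  ~~ prefix p q -> ~~ prefix q p -> q \in level t (size q) ->
  q \in level (replace t p u) (size q).
Proof.
elim: t p q => [k s|k l IHl r IHr] [|[] p] [|[] q] //;
  rewrite ?prefix_cons ?eqxx [size (_ :: _)]/= [replace _ _ _]/=;
  rewrite !mem_level_node //; [exact: IHr | exact: IHl].
Qed.

Lemma subtree_replace t u p q :
  ~~ prefix p q -> ~~ prefix q p ->
  subtree (replace t p u) q = subtree t q.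
Proof.
elim: t p q => [k s|k l IHl r IHr] [|[] p] [|[] q] //=;
  by rewrite ?prefix_cons ?eqxx /= => pq qp; rewrite ?IHl ?IHr.
Qed.

(** The hypothesis makes [p] a genuine position: past a leaf, [replace] changes nothing while
    [subtree] still returns the leaf. Adding the removed symbols on the left avoids a multiset
    subtraction. *)
Lemma perm_symbols_replace t u p :
  p \in level t (size p) ->
  perm_eq (symbols (replace t p u) ++ symbols (subtree t p))
          (symbols t ++ symbols u).
Proof.
elim: t p => [k s|k l IHl r IHr] [|b p] //; try by rewrite perm_catC.
rewrite mem_level_node; case: b => /= pt; first by rewrite -!catA perm_cat2l IHr.
rewrite perm_catAC perm_sym perm_catAC perm_sym perm_cat2r.
exact: IHl.
Qed.

Lemma perm_symbols_swap t p q :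
  ~~ prefix p q -> ~~ prefix q p ->
  p \in level t (size p) -> q \in level t (size q) ->
  perm_eq (symbols (swap t p q)) (symbols t).
Proof.
(* With the symbols below [q] added to both sides, the swap becomes two successive replacements, at
   [p] and then at [q]. *)
move=> pq qp pt qt; rewrite -(perm_cat2r (symbols (subtree t q))).
have qt1 := mem_level_replace _ (subtree t q) _ _ pq qp qt.
have := perm_symbols_replace _ (subtree t p) _ qt1.
rewrite subtree_replace // => /perm_trans; apply.
exact: perm_symbols_replace.
Qed.

Lemma symbols_incr_at t p : symbols (incr_at t p) = symbols t.
Proof.
rewrite /incr_at; elim: t p => [k s|k l IHl r IHr] [|[] p] //=.
  by rewrite IHr.
by rewrite IHl.
Qed.

Lemma perm_symbols_promote t p :
  perm_eq (symbols (promote t p).1) (symbols t).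
Proof.
rewrite /promote; case def_qs: (successors t p) => [//|q0 qs].
case: ifP => // _; set q := last _ _; case: ifP => //= /negbT qp.
(* The default [q0] of [last] is itself a successor, so an empty filter does no harm. *)
have q_succ: q \in successors t p.
  have: q \in q0 :: [seq q' <- q0 :: qs | freq_at t q' <= freq_at t p].
    exact: mem_last.
  by rewrite def_qs inE mem_filter => /orP[/eqP->|/andP[]]; rewrite ?mem_head.
(* Otherwise [index] would be the length of the list, and [p] would have no successors. *)
have pt: p \in node_order t.
  rewrite -index_mem ltnNge; apply/negP=> pt.
  by move: def_qs; rewrite /successors drop_oversize // ltnW.
have qt: q \in node_order t by apply: mem_drop q_succ.
apply: perm_symbols_swap; rewrite ?mem_node_order //.
(* If [p] were a prefix of [q], which is no longer than [p], then [q = p], and the test [prefix q p]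
   would have succeeded. *)
apply: contra qp => /prefixP[v def_q].
have := successors_size _ _ _ pt q_succ.
rewrite def_q size_cat -[leqRHS]addn0 leq_add2l leqn0 => /nilP->.
by rewrite cats0 prefix_refl.
Qed.

Lemma perm_symbols_sibling_loop n t p :
  perm_eq (symbols (sibling_loop n t p)) (symbols t).
Proof.
elim: n t p => [|n IHn] t p /=; have := perm_symbols_promote t p;
  case: (promote t p) => t1 [|b q] /= t1_t; rewrite ?symbols_incr_at //.
by apply: perm_trans (IHn _ _) _; rewrite symbols_incr_at.
Qed.

Lemma mem_symbols_sibling_transformation t s :
  symbols (sibling_transformation t s) =i symbols t.
Proof. exact/perm_mem/perm_symbols_sibling_loop. Qed.

Lemma perm_symbols_huffman ts t :
  huffman_from ts t -> perm_eq (symbols t) (flatten (map (@symbols Sigma) ts)).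
Proof.
elim=> {ts t} [t|ts x y rest t ts_xy _ _ IH] /=; first by rewrite cats0.
apply: perm_trans IH _; rewrite /= -catA perm_sym.
exact: (perm_flatten (perm_map _ ts_xy)).
Qed.

(** At the first node sending the two symbols to different sides, the bits differ. The tails [v1]
    and [v2] stand for the rest of an encoded message. *)
Lemma code_prefix_free t s1 s2 v1 v2 :
  s1 \in symbols t -> s2 \in symbols t ->
  code s1 t ++ v1 = code s2 t ++ v2 -> s1 = s2.
Proof.
elim: t => [k s|k l IHl r IHr] /=; first by rewrite !inE => /eqP-> /eqP->.
rewrite !mem_cat; case: ifP => [s1l|s1l]; case: ifP => [s2l|s2l] //= s1r s2r [].
  exact: IHl.
exact: IHr.
Qed.

End SymbolsPreserved.

Section Encoding.
Variable Sigma : finType.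
Implicit Types (t : htree Sigma) (s : Sigma) (w : seq Sigma).

(** Only a single leaf gives an empty codeword, and it cannot carry two distinct symbols. *)
Lemma code_neq_nil t s :
  1 < #|Sigma| -> (forall s', s' \in symbols t) -> code s t != [::].
Proof.
case: t => [k s0|k l r] /=; last by case: ifP.
case/card_gt1P=> [x [y [_ _ xy]]] all_s; move: (all_s x) (all_s y) xy.
by rewrite !inE => /eqP-> /eqP->; rewrite eqxx.
Qed.

(** The decoder's view: only the current tree is carried along, which suits induction on the
    word. *)
Fixpoint encode_from t w : seq bool :=
  if w is s :: w' then code s t ++ encode_from (sibling_transformation t s) w'
  else [::].

Lemma adaptive_huffman_encode_from t w :
  adaptive_huffman_encode t w = encode_from t w.
Proof.
(* The empty prefix is made explicit so that it generalizes to the part [u] already read, which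
   fixes both the starting index and the current tree. *)
rewrite /adaptive_huffman_encode -{1}[w]cat0s -[0]/(size (@nil Sigma)).
rewrite -[t in RHS]/(foldl (@sibling_transformation Sigma) t [::]).
elim: w [::] => [//|s w IHw] u /=; rewrite /adaptive_tree take_size_cat //.
by congr (_ ++ _); rewrite -cat_rcons -(size_rcons u s) IHw foldl_rcons.
Qed.

Lemma encode_from_inj t :
  1 < #|Sigma| -> (forall s, s \in symbols t) -> injective (encode_from t).
Proof.
move=> Sigma_gt1 + w1 w2.
have nil_cons t' s w : (forall s', s' \in symbols t') ->
    [::] <> encode_from t' (s :: w).
  by move=> all_s /=; case: (code s t') (code_neq_nil _ s Sigma_gt1 all_s).
elim: w1 t w2 => [|s1 w1 IHw] t [|s2 w2] all_s //; try by move/nil_cons.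
  by move/esym/nil_cons.
move=> /= eq_enc.
have eq_s := code_prefix_free _ _ _ _ _ _ (all_s s1) (all_s s2) eq_enc.
(* Dropping the common first codeword leaves two encodings from the same updated tree. *)
move: eq_enc; rewrite eq_s => /(congr1 (drop (size (code s2 t)))).
rewrite !drop_size_cat // => /IHw-> // s.
by rewrite mem_symbols_sibling_transformation.
Qed.

Lemma ga_encode_adaptive t w :
  ga_encode (fun i => take i.-1)
    (fun s u => code s (foldl (@sibling_transformation Sigma) t u)) w
  = adaptive_huffman_encode t w.
Proof.
rewrite /ga_encode /adaptive_huffman_encode /adaptive_tree; congr flatten.
(* Only the traversed copies of [w] and the starting index vary; the word read by [F] and by the
   tree stays fixed. Positions count from 1 on the left and from 0 on the right, whence [i.-1]. *)
by elim: {2 3 5 6}w 0 => //= s w' IHw i; rewrite IHw.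
Qed.

End Encoding.

Theorem theorem3p1 (Sigma : finType) (Sigma_gt1 : 1 < #|Sigma|)
    (T0 : htree Sigma) (T0_huffman : initial_huffman_tree T0) :
  exists (F : nat -> seq Sigma -> seq Sigma)
         (c : Sigma -> seq Sigma -> seq bool),
    ga_code F c /\
    (forall w : seq Sigma, w != [::] ->
       ga_encode F c w = adaptive_huffman_encode T0 w).
Proof.
have all_T0 s : s \in symbols T0.
  rewrite (perm_mem (perm_symbols_huffman _ _ _ T0_huffman)).
  apply/flatten_mapP; exists (Leaf 1 s); last exact: mem_head.
  by rewrite map_f // mem_enum.
exists (fun i => take i.-1),
  (fun s u => code s (foldl (@sibling_transformation Sigma) T0 u)).
split; last by move=> w _; exact: ga_encode_adaptive.
split=> [s u|w1 w2].
  apply: code_neq_nil => // s'; elim/last_ind: u => [//|u x IHu].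
  by rewrite foldl_rcons mem_symbols_sibling_transformation.
rewrite !ga_encode_adaptive !adaptive_huffman_encode_from.
exact: encode_from_inj.
Qed.
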